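(* Let $0<q<1$, $a,b,c,d\in\mathbb{C}$ generic, $z\in\mathbb{C}\setminus\{0\}$, $x=(z+z^{-1})/2$, and $n\ge1$. Define an $(n+1)\times(n+1)$ matrix $(A_{i,j})_{0\le i,j\le n}$ by $$A_{i,j}=(ac,ad;q)_i\,(bc,bd;q)_j\,\frac{(ab;q)_{i+j}}{(abcd;q)_{i+j}}\quad(0\le i\le n-1,\ 0\le j\le n),\qquad A_{n,j}=(bz,b/z;q)_j\quad(0\le j\le n).$$ Then $\det(A_{i,j})_{0\le i,j\le n}=C\cdot p_n(x;a,b,c,d;q)$, where $$C=(-1)^n a^{n(n-1)/2}b^{n(n+1)/2}q^{n(n-1)(2n-1)/6}\prod_{i=0}^{n-1}\frac{(ab,ac,ad,bc,bd,cd,q;q)_i}{(abcd;q)_{n+i}}.$$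
   Context: $(a;q)_n=\prod_{k=0}^{n-1}(1-aq^k)$ for $n\ge0$, and $(a_1,\dots,a_m;q)_n=\prod_i(a_i;q)_n$. The Askey–Wilson polynomials are, with $x=\cos\theta$, $e^{I\theta}$ playing the role of $z$ ($I^2=-1$), $p_n(x;a,b,c,d;q)=\frac{(ab,ac,ad;q)_n}{a^n}\sum_{k=0}^{n}\frac{(q^{-n},abcdq^{n-1},az,a/z;q)_k}{(q,ab,ac,ad;q)_k}q^k,$ a polynomial of degree $n$ in $x=(z+z^{-1})/2$. *)

(* Defs.v *)
From mathcomp Require Import all_boot all_order all_algebra.
From mathcomp Require Export complex.
From mathcomp Require Export reals.

Set Implicit Arguments.
Unset Strict Implicit.
Unset Printing Implicit Defensive.

Import Order.TTheory GRing.Theory Num.Theory.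
Local Open Scope ring_scope.

Definition qpoch (F : fieldType) (q a : F) (n : nat) : F :=
  \prod_(k < n) (1 - a * q ^+ k).

Definition qpochs (F : fieldType) (q : F) (s : seq F) (n : nat) : F :=
  \prod_(a <- s) qpoch q a n.

(* The Askey-Wilson expression in the variable z.  For n = 0 the exponent
   n.-1 is immaterial, since only the term k = 0 occurs. *)
Definition askey_wilson_z (F : fieldType) (q a b c d : F) (n : nat) (z : F) : F :=
  qpochs q [:: a * b; a * c; a * d] n / a ^+ n *
  \sum_(k < n.+1)
    qpochs q [:: q ^- n; a * b * c * d * q ^+ n.-1; a * z; a / z] k /
    qpochs q [:: q; a * b; a * c; a * d] k * q ^+ k.

(* p_n(x; a, b, c, d; q) as a function of x: the expression above evaluated at
   one of the two solutions z of (z + z^-1) / 2 = x.  These solutions are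
   mutually inverse, so the choice is irrelevant: see askey_wilsonE. *)
Definition askey_wilson (C : numClosedFieldType) (q a b c d : C) (n : nat)
    (x : C) : C :=
  askey_wilson_z q a b c d n (x + sqrtC (x ^+ 2 - 1)).

Lemma askey_wilson_zV (F : fieldType) (q a b c d : F) n z :
  askey_wilson_z q a b c d n z^-1 = askey_wilson_z q a b c d n z.
Proof.
rewrite /askey_wilson_z; congr (_ * _); apply: eq_bigr => k _.
congr (_ / _ * _); rewrite /qpochs !big_cons big_nil invrK.
by congr (_ * (_ * _)); rewrite !mulr1 mulrC.
Qed.

Lemma askey_wilsonE (C : numClosedFieldType) (q a b c d : C) n z : z != 0 ->
  askey_wilson q a b c d n ((z + z^-1) / 2%:R) = askey_wilson_z q a b c d n z.
Proof.
move=> z0; rewrite /askey_wilson; set x := (z + z^-1) / 2%:R.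
have n2 : (2%:R : C) != 0 by rewrite pnatr_eq0.
have xD : x + (z - z^-1) / 2%:R = z.
  by rewrite -mulrDl addrACA subrr addr0 -mulr2n -(mulr_natr z) mulfK.
have xB : x - (z - z^-1) / 2%:R = z^-1.
  rewrite -mulrBl opprB addrC subrKA.
  by rewrite -mulr2n -(mulr_natr z^-1) mulfK.
have : sqrtC (x ^+ 2 - 1) ^+ 2 == ((z - z^-1) / 2%:R) ^+ 2.
  by rewrite sqrtCK subr_eq addrC -subr_eq subr_sqr xB xD mulVf.
rewrite eqf_sqr => /orP[] /eqP ->; first by rewrite xD.
by rewrite xB askey_wilson_zV.
Qed.

(* Entry (i, j) of the matrix A; rows i < n and the last row i = n. *)
Definition aw_entry (F : fieldType) (q a b c d z : F) (n i j : nat) : F :=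
  if (i < n)%N then
    qpochs q [:: a * c; a * d] i * qpochs q [:: b * c; b * d] j *
    (qpoch q (a * b) (i + j) / qpoch q (a * b * c * d) (i + j))
  else qpochs q [:: b * z; b / z] j.

Definition aw_matrix (F : fieldType) (q a b c d z : F) (n : nat) : 'M[F]_n.+1 :=
  \matrix_(i < n.+1, j < n.+1) aw_entry q a b c d z n i j.

(* The divisions of natural number exponents are exact. *)
Definition aw_const (F : fieldType) (q a b c d : F) (n : nat) : F :=
  (-1) ^+ n * a ^+ ((n * (n - 1)) %/ 2) * b ^+ ((n * (n + 1)) %/ 2) *
  q ^+ ((n * (n - 1) * (2 * n - 1)) %/ 6) *
  \prod_(i < n)
    (qpochs q [:: a * b; a * c; a * d; b * c; b * d; c * d; q] i /
     qpoch q (a * b * c * d) (n + i)).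

(* Main.v *)
(* The rows i < n of the matrix are the values on (az, a/z; q)_i (bz, b/z; q)_j of
   a moment functional making the Askey-Wilson polynomials orthogonal.  Hence
   combining its columns with the coefficients of p_m in the basis
   (bz, b/z; q)_k gives a lower triangular matrix, whose entries are evaluated by
   the q-Pfaff-Saalschuetz sum and whose last diagonal entry is p_n written in
   terms of b.  Sears' transformation, also a consequence of that sum, identifies
   it with p_n written in terms of a. *)
Require Import Defs.
From mathcomp Require Import all_boot all_order all_algebra.
From mathcomp Require Import complex reals.
From mathcomp Require Import ring zify.

Set Implicit Arguments.
Unset Strict Implicit.
Unset Printing Implicit Defensive.

Import Order.TTheory GRing.Theory Num.Theory.
Local Open Scope ring_scope.
Local Open Scope complex_scope.

(** * Shifted factorials *)

Lemma qpoch0 (F : fieldType) (q a : F) : qpoch q a 0 = 1.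
Proof. exact: big_ord0. Qed.

Lemma qpochS (F : fieldType) (q a : F) n :
  qpoch q a n.+1 = qpoch q a n * (1 - a * q ^+ n).
Proof. exact: big_ord_recr. Qed.

Lemma qpochSl (F : fieldType) (q a : F) n :
  qpoch q a n.+1 = (1 - a) * qpoch q (a * q) n.
Proof.
rewrite /qpoch big_ord_recl mulr1; congr (_ * _).
by apply: eq_bigr => i _; rewrite /= exprS mulrA.
Qed.

Lemma qpochD (F : fieldType) (q a : F) m n :
  qpoch q a (m + n) = qpoch q a m * qpoch q (a * q ^+ m) n.
Proof.
elim: n => [|n IHn]; first by rewrite addn0 qpoch0 mulr1.
by rewrite addnS !qpochS IHn exprD; ring.
Qed.

Lemma qpoch_neq0 (F : fieldType) (q a : F) n :
  (forall k, (k < n)%N -> a * q ^+ k != 1) -> qpoch q a n != 0.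
Proof.
move=> h; apply/prodf_neq0 => i _.
by rewrite subr_eq0 eq_sym h.
Qed.

Lemma qpoch_eq0 (F : fieldType) (q a : F) k n :
  (k < n)%N -> a * q ^+ k = 1 -> qpoch q a n = 0.
Proof.
move=> kn aqk; apply/eqP/prodf_eq0; exists (Ordinal kn) => //=.
by rewrite aqk subrr.
Qed.

Lemma qpochqq_neq0 (F : fieldType) (q : F) n :
  (forall k, q ^+ k.+1 != 1) -> qpoch q q n != 0.
Proof. by move=> q1; apply: qpoch_neq0 => k _; rewrite -exprS. Qed.

(** * The q-Pfaff-Saalschuetz sum *)

(* The certificate on the right was found by q-Zeilberger summation: the summand
   of [q_saalschutz] satisfies a first order recurrence in [N] modulo a telescoping
   term. *)
Lemma q_saalschutz_telescope (F : fieldType) (q A u v : F) N M :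
  q != 0 -> (forall k, q ^+ k.+1 != 1) -> (M <= N)%N ->
  let term n r := qpoch q (q ^- n) r / qpoch q q r * q ^+ r *
    (qpoch q A r * qpoch q (A * u * v * q ^+ n / q) r *
     (qpoch q (A * u * q ^+ r) (n - r) * qpoch q (A * v * q ^+ r) (n - r))) in
  \sum_(r < M.+1)
    (term N.+1 r - A * (1 - u * q ^+ N) * (1 - v * q ^+ N) * term N r) =
  qpoch q (q ^- N) M / qpoch q q M * (1 - A * u * v * q ^+ (N + N)) *
    (qpoch q A M.+1 * qpoch q (A * u * v * q ^+ N) M *
     (qpoch q (A * u * q ^+ M) (N - M) * qpoch q (A * v * q ^+ M) (N - M))).
Proof.
move=> q0 q1 + term; elim: M => [_|M IHM ltMN].
  rewrite big_ord_recl big_ord0 addr0 /term !subn0 !qpochS !qpoch0 !expr0.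
  by rewrite exprD; field; apply: oner_neq0.
rewrite big_ord_recr /= IHM; last exact: ltnW.
(* With [N = M + 1 + p] the truncated subtractions become [p] and [p + 1]; all factorials then
   reduce to common ones times explicit factors, leaving a rational identity. *)
have -> : N = (M.+1 + (N - M.+1))%N by rewrite subnKC.
set p := (N - M.+1)%N; rewrite /term.
have -> : (M.+1 + p - M = p.+1)%N by lia.
have -> : ((M.+1 + p).+1 - M.+1 = p.+1)%N by lia.
have -> : (M.+1 + p - M.+1 = p)%N by lia.
have EV : q ^- (M.+1 + p).+1 * q = q ^- (M.+1 + p).
  by rewrite exprSr invfM mulfVK.
have EW : A * u * v * q ^+ (M.+1 + p) / q * q = A * u * v * q ^+ (M.+1 + p).
  by rewrite mulfVK.
have EW' : A * u * v * q ^+ (M.+1 + p).+1 / q = A * u * v * q ^+ (M.+1 + p).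
  by rewrite exprSr mulrA mulfK.
rewrite EW' (qpochSl q (q ^- (M.+1 + p).+1)) EV.
rewrite (qpochSl q (A * u * v * q ^+ (M.+1 + p) / q)) EW.
rewrite (qpochSl q (A * u * q ^+ M)) (qpochSl q (A * v * q ^+ M)).
rewrite -!(mulrA _ (q ^+ M) q) -!exprSr.
rewrite (qpochS q (q ^- _)) (qpochS q q) (qpochS q A M.+1) (qpochS q _ p).
rewrite (qpochS q (A * v * q ^+ M.+1) p) (qpochS q (A * u * v * _) M).
have := q1 M; have := expf_neq0 p q0; have := expf_neq0 M q0.
have := qpochqq_neq0 M q1.
rewrite !(exprD, exprS).
move: (qpoch q q M) (qpoch q A _) (qpoch q _^-1 M)
  (qpoch q (A * u * v * _) M) (qpoch q (A * u * _) p) (qpoch q (A * v * _) p)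
  => Q X E W U V Q0; move: (q ^+ M) (q ^+ p) => x y x0 y0 qx.
field; rewrite q0 x0 y0 Q0 /=.
by rewrite subr_eq0 eq_sym qx.
Qed.

(* The q-Pfaff-Saalschuetz sum with numerator parameters q^-N, A, A u v q^(N-1)
   and denominator parameters A u, A v, multiplied by (A u, A v; q)_N so that
   it holds without genericity assumptions. *)
Lemma q_saalschutz (F : fieldType) (q A u v : F) N :
  q != 0 -> (forall k, q ^+ k.+1 != 1) ->
  \sum_(r < N.+1) qpoch q (q ^- N) r / qpoch q q r * q ^+ r *
    (qpoch q A r * qpoch q (A * u * v * q ^+ N / q) r *
     (qpoch q (A * u * q ^+ r) (N - r) * qpoch q (A * v * q ^+ r) (N - r))) =
  A ^+ N * (qpoch q u N * qpoch q v N).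
Proof.
move=> q0 q1; elim: N => [|N IHN].
  by rewrite big_ord_recl big_ord0 !qpoch0 expr0 addr0 !(mulr1, divr1).
(* The telescoped sum stops at [r = N]; its boundary value cancels the extra term [r = N + 1] of the
   sum for [N + 1]. *)
have := q_saalschutz_telescope A u v q0 q1 (leqnn N).
rewrite /= sumrB -mulr_sumr IHN => /eqP; rewrite subr_eq => /eqP H.
rewrite big_ord_recr /= {}H !subnn !qpoch0.
have -> : A * u * v * q ^+ N.+1 / q = A * u * v * q ^+ N.
  by rewrite exprSr mulrA mulfK.
rewrite (qpochSl q (q ^- N.+1)).
have -> : q ^- N.+1 * q = q ^- N by rewrite exprSr invfM mulfVK.
rewrite !qpochS exprD.
have := q1 N; have := qpochqq_neq0 N q1; have := expf_neq0 N q0.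
rewrite !exprS.
move: (qpoch q q N) (qpoch q A N) (qpoch q _^-1 N)
  (qpoch q (A * u * v * _) N) (qpoch q u N) (qpoch q v N)
  => Q X E W U V x0 Q0; move: (q ^+ N) x0 => x x0 qx.
field; rewrite q0 x0 Q0 /=.
by rewrite subr_eq0 eq_sym qx.
Qed.

(** * Change of basis from (az, a/z; q)_k to (bz, b/z; q)_j *)

Lemma qpochs_cons (F : fieldType) (q a : F) s n :
  qpochs q (a :: s) n = qpoch q a n * qpochs q s n.
Proof. exact: big_cons. Qed.

Lemma qpochs_nil (F : fieldType) (q : F) n : qpochs q [::] n = 1.
Proof. exact: big_nil. Qed.

Lemma sum_ordD_shift (V : zmodType) (f g : nat -> V) k :
  \sum_(j < k.+1) (f j + g j) = g 0 + \sum_(j < k) (f j + g j.+1) + f k.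
Proof.
elim: k => [|k IHk]; first by rewrite big_ord1 big_ord0 addr0 addrC.
by rewrite big_ord_recr IHk [in RHS]big_ord_recr /= [f k.+1 + _]addrC !addrA.
Qed.

Definition aw_connection (F : fieldType) (q a b : F) (n j : nat) : F :=
  qpoch q q n / (qpoch q q j * qpoch q q (n - j)) * (a / b) ^+ j *
  (qpoch q (a / b) (n - j) * qpoch q (a * b * q ^+ j) (n - j)).

(** A Pascal-type rule: passing from [k] to [k + 1] multiplies by a factor affine in z + 1/z, which
    sends the basis element [j] to a combination of the elements [j] and [j + 1]. *)
Lemma aw_connectionS (F : fieldType) (q a b : F) k j :
  q != 0 -> (forall k, q ^+ k.+1 != 1) -> b != 0 -> (j < k)%N ->
  aw_connection q a b k.+1 j.+1 =
  aw_connection q a b k j * (a / b * q ^+ (k - j)) +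
  aw_connection q a b k j.+1 *
    ((1 - a / b * q ^+ (k - j.+1)) * (1 - a * b * q ^+ (k + j.+1))).
Proof.
move=> q0 q1 b0 ltjk; have Q0 n := qpochqq_neq0 n q1.
have q1' n : 1 - q ^+ n * q != 0 by rewrite subr_eq0 eq_sym -exprSr q1.
have -> : k = (j.+1 + (k - j.+1))%N by rewrite subnKC.
move: (k - j.+1)%N => p; rewrite /aw_connection.
have -> : (j.+1 + p - j = p.+1)%N by lia.
have -> : ((j.+1 + p).+1 - j.+1 = p.+1)%N by lia.
have -> : (j.+1 + p - j.+1 = p)%N by lia.
rewrite (qpochSl q (a * b * q ^+ j)) -(mulrA _ (q ^+ j) q) -exprSr.
rewrite !(qpochS q q) !(qpochS q (a / b)) (qpochS q _ p).
have := q1' p; have := q1' j; have := q1' (j.+1 + p)%N.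
have := Q0 p; have := Q0 j; have := Q0 (j.+1 + p)%N.
rewrite !(exprD, exprSr).
move: (qpoch q q (j.+1 + p)) (qpoch q q j) (qpoch q q p) (qpoch q (a / b) p)
  (qpoch q (a * b * _) p) => A B C D E A0 B0 C0.
move: (q ^+ j) (q ^+ p) ((a / b) ^+ j) => x y z xy0 x0 y0.
by field; rewrite b0 B0 C0 (mulrC q x) (mulrC q y) x0.
Qed.

Lemma askey_wilson_basis_connection (F : fieldType) (q a b z : F) k :
  q != 0 -> (forall k, q ^+ k.+1 != 1) -> b != 0 -> z != 0 ->
  qpochs q [:: a * z; a / z] k =
  \sum_(j < k.+1) aw_connection q a b k j * qpochs q [:: b * z; b / z] j.
Proof.
move=> q0 q1 b0 z0; elim: k => [|k IHk].
  rewrite big_ord_recl big_ord0 !qpochs_cons !qpochs_nil /aw_connection.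
  by rewrite !qpoch0 expr0 addr0 !mulr1 divr1.
have Q0 n := qpochqq_neq0 n q1.
(* The new factor is divided by (1 - bzq^j)(1 - bq^j/z), both being affine in z + 1/z; the constant
   remainder happens to factor. *)
have step j : (j <= k)%N ->
  (1 - a * z * q ^+ k) * (1 - a / z * q ^+ k) * qpochs q [:: b * z; b / z] j =
  a / b * q ^+ (k - j) * qpochs q [:: b * z; b / z] j.+1 +
  (1 - a / b * q ^+ (k - j)) * (1 - a * b * q ^+ (k + j)) *
    qpochs q [:: b * z; b / z] j.
  move=> lejk; rewrite !qpochs_cons !qpochs_nil !qpochS.
  rewrite -(subnK lejk); move: (k - j)%N => p.
  rewrite addnK !exprD; field; rewrite b0; exact: z0.
have -> : qpochs q [:: a * z; a / z] k.+1 =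
    (1 - a * z * q ^+ k) * (1 - a / z * q ^+ k) * qpochs q [:: a * z; a / z] k.
  by rewrite !qpochs_cons !qpochs_nil !qpochS; ring.
rewrite IHk mulr_sumr.
move: (qpochs q [:: b * z; b / z]) step => psi step.
pose f j := aw_connection q a b k j * (a / b * q ^+ (k - j)) * psi j.+1.
pose g j := aw_connection q a b k j *
  ((1 - a / b * q ^+ (k - j)) * (1 - a * b * q ^+ (k + j))) * psi j.
transitivity (\sum_(j < k.+1) (f j + g j)).
  apply: eq_bigr => j _; rewrite mulrCA step -1?ltnS // mulrDr.
  by congr (_ + _); apply: mulrA.
rewrite sum_ordD_shift [RHS]big_ord_recl [in RHS]big_ord_recr /= addrA.
(* The extreme indices [k + 1] and [0] receive one contribution each; the others follow the
   Pascal-type rule. *)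
congr (_ + _ + _); last 1 first.
- rewrite /f /aw_connection !subnn !qpoch0 !qpochS !exprS.
  have := q1 k; have := Q0 k; rewrite exprS; move: (qpoch q q k) => A A0 qk.
  by field; rewrite A0 b0 subr_eq0 eq_sym qk.
- rewrite /g /aw_connection !subn0 addn0 !qpoch0 !expr0 !qpochS.
  have := q1 k; have := Q0 k; rewrite exprS; move: (qpoch q q k) => A A0 qk.
  by field; rewrite A0 b0 subr_eq0 eq_sym qk.
by apply: eq_bigr => j _; rewrite /f /g -mulrDl aw_connectionS.
Qed.

(** * Sears' transformation *)

Lemma sum_triangle (V : zmodType) (G : nat -> nat -> V) n :
  \sum_(k < n.+1) \sum_(j < k.+1) G k j =
  \sum_(j < n.+1) \sum_(r < (n - j).+1) G (j + r)%N j.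
Proof.
elim: n => [|n IHn]; first by rewrite !big_ord1.
rewrite big_ord_recr IHn [RHS]big_ord_recr /= subnn big_ord1 addn0.
rewrite [\sum_(j < n.+2) _]big_ord_recr /= addrA; congr (_ + _).
rewrite -big_split; apply: eq_bigr => j _ /=.
have lejn : (j <= n)%N by rewrite -ltnS.
by rewrite subSn // [RHS]big_ord_recr /= addnS subnKC.
Qed.

(** The tails (abq^k; q)_(n-k) stand for (ab; q)_n / (ab; q)_k without division, and [q ^+ n / q]
    for q^(n-1) without truncation at [n = 0]. *)
Definition aw_coef (F : fieldType) (q a b c d : F) (n k : nat) : F :=
  qpoch q (q ^- n) k / qpoch q q k * q ^+ k *
  qpoch q (a * b * c * d * q ^+ n / q) k *
  (qpoch q (a * b * q ^+ k) (n - k) *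
   (qpoch q (a * c * q ^+ k) (n - k) * qpoch q (a * d * q ^+ k) (n - k))).

(* This is [a ^+ n] times the Askey-Wilson polynomial, with the denominators
   [(ab, ac, ad; q)_k] cancelled against the prefactor. *)
Definition aw_sum (F : fieldType) (q a b c d z : F) (n : nat) : F :=
  \sum_(k < n.+1) aw_coef q a b c d n k * qpochs q [:: a * z; a / z] k.

(* Sears' transformation: expand the basis in [a] in the basis in [b]; the inner
   sum is then Saalschuetzian. *)
Lemma aw_sum_sears (F : fieldType) (q a b c d z : F) n :
  q != 0 -> (forall k, q ^+ k.+1 != 1) -> b != 0 -> z != 0 ->
  aw_sum q a b c d z n = (a / b) ^+ n * aw_sum q b a c d z n.
Proof.
move=> q0 q1 b0 z0; rewrite /aw_sum.
under eq_bigr do rewrite (askey_wilson_basis_connection a _ q0 q1 b0 z0) mulr_sumr.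
rewrite (sum_triangle (fun k j => aw_coef q a b c d n k *
  (aw_connection q a b k j * qpochs q [:: b * z; b / z] j))) mulr_sumr.
apply: eq_bigr => -[j ltjn] _ /=.
have -> : n = (j + (n - j))%N by rewrite subnKC.
move: (n - j)%N => N; rewrite addKn {ltjn}.
under eq_bigr do rewrite mulrA.
rewrite -mulr_suml mulrA; congr (_ * _).
have qj0 := expf_neq0 j q0; have Qj0 := qpochqq_neq0 j q1.
(* The coefficient of (bz, b/z; q)_j is a Saalschuetz sum with [A = a / b], [u = b * c * q ^+ j] and
   [v = b * d * q ^+ j], so that Au = acq^j and Av = adq^j. *)
transitivity ((a / b) ^+ j * (qpoch q (q ^- (j + N)) j / qpoch q q j * q ^+ j) *
  qpoch q (a * b * c * d * q ^+ (j + N) / q) j * qpoch q (a * b * q ^+ j) N *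
  \sum_(r < N.+1) qpoch q (q ^- N) r / qpoch q q r * q ^+ r *
    (qpoch q (a / b) r *
     qpoch q (a / b * (b * c * q ^+ j) * (b * d * q ^+ j) * q ^+ N / q) r *
     (qpoch q (a / b * (b * c * q ^+ j) * q ^+ r) (N - r) *
      qpoch q (a / b * (b * d * q ^+ j) * q ^+ r) (N - r)))).
  rewrite mulr_sumr; apply: eq_bigr => -[r ltrN] _ /=.
  have -> : a / b * (b * c * q ^+ j) * (b * d * q ^+ j) * q ^+ N / q =
    a * b * c * d * q ^+ (j + N) / q * q ^+ j.
    by rewrite exprD; field; rewrite q0 b0.
  have -> : a / b * (b * c * q ^+ j) * q ^+ r = a * c * q ^+ (j + r).
    rewrite exprD; field; exact: b0.
  have -> : a / b * (b * d * q ^+ j) * q ^+ r = a * d * q ^+ (j + r).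
    rewrite exprD; field; exact: b0.
  rewrite /aw_coef /aw_connection addKn subnDl.
  have -> : qpoch q (a * b * q ^+ j) N = qpoch q (a * b * q ^+ j) r *
      qpoch q (a * b * q ^+ (j + r)) (N - r).
    by rewrite -[in LHS](@subnKC r N) // qpochD exprD mulrA.
  have -> : qpoch q (q ^- (j + N)) (j + r) =
      qpoch q (q ^- (j + N)) j * qpoch q (q ^- N) r.
    by rewrite qpochD; congr (_ * qpoch _ _ _); rewrite exprD; field; rewrite qj0 expf_neq0.
  rewrite (qpochD q (a * b * c * d * _ / q) j r) (exprD q j r).
  have Qr0 := qpochqq_neq0 r q1; have Qjr0 := qpochqq_neq0 (j + r) q1.
  by field; rewrite Qr0 Qjr0 Qj0.
rewrite q_saalschutz //.
rewrite /aw_coef addKn (mulrC b a) (exprD (a / b)).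
ring.
Qed.

(** * Triangularization of the matrix *)

Definition aw_pivot (F : fieldType) (q a b c d : F) (i m : nat) : F :=
  qpochs q [:: a * b; a * c; a * d] i * qpochs q [:: b * c; b * d] m /
  qpoch q (a * b * c * d) (i + m) *
  ((a * b * q ^+ i) ^+ m * (qpoch q (q ^- i) m * qpoch q (c * d) m)).

(** Saalschuetz with [A = a * b * q ^+ i], [u = q ^- i] and [v = c * d]. The resulting factor (q^-i;
    q)_m vanishes for [i < m], which expresses orthogonality of p_m to (az, a/z; q)_i. *)
Lemma aw_row_sum (F : fieldType) (q a b c d : F) i m :
  q != 0 -> (forall k, q ^+ k.+1 != 1) ->
  qpoch q (a * b * c * d) (i + m) != 0 ->
  \sum_(k < m.+1) qpochs q [:: a * c; a * d] i * qpochs q [:: b * c; b * d] k *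
    (qpoch q (a * b) (i + k) / qpoch q (a * b * c * d) (i + k)) *
    aw_coef q b a c d m k = aw_pivot q a b c d i m.
Proof.
move=> q0 q1 s0; rewrite /aw_pivot -q_saalschutz //.
rewrite mulr_sumr; apply: eq_bigr => -[k ltkm] _ /=.
rewrite /aw_coef !qpochs_cons !qpochs_nil.
have Dm (x : F) : qpoch q x m = qpoch q x k * qpoch q (x * q ^+ k) (m - k).
  by rewrite -qpochD subnKC.
have sim : qpoch q (a * b * c * d) (i + m) = qpoch q (a * b * c * d) (i + k) *
    qpoch q (a * b * c * d * q ^+ (i + k)) (m - k).
  by rewrite -qpochD -addnA subnKC.
have qi0 := expf_neq0 i q0.
rewrite !Dm (qpochD q (a * b) i k) (mulrC b a).
have -> : a * b * q ^+ i / q ^+ i * (c * d) * q ^+ m / q =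
  a * b * c * d * q ^+ m / q by field; rewrite q0 qi0.
have -> : a * b * q ^+ i * (c * d) * q ^+ k = a * b * c * d * q ^+ (i + k).
  by rewrite exprD; ring.
have -> : a * b * q ^+ i / q ^+ i = a * b by rewrite mulfK.
move: s0; rewrite sim mulf_eq0 negb_or => /andP[s1 s2].
have Qk0 := qpochqq_neq0 k q1.
by field; rewrite Qk0 s1 s2.
Qed.

Lemma aw_pivot_eq0 (F : fieldType) (q a b c d : F) i m :
  q != 0 -> (i < m)%N -> aw_pivot q a b c d i m = 0.
Proof.
move=> q0 ltim; rewrite /aw_pivot (qpoch_eq0 ltim) ?mul0r ?mulr0 //.
by rewrite mulVf // expf_neq0.
Qed.

Lemma sum_ord_widen_if (R : pzRingType) (f g : nat -> R) m n : (m <= n)%N ->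
  \sum_(k < n.+1) f k * (if (k <= m)%N then g k else 0) =
  \sum_(k < m.+1) f k * g k.
Proof.
move=> lemn; rewrite [RHS](big_ord_widen n.+1 (fun k => f k * g k)) // [RHS]big_mkcond.
by apply: eq_bigr => k _; rewrite ltnS; case: ifP => // _; rewrite mulr0.
Qed.

(* Right multiplication by the upper triangular matrix of coefficients of the
   polynomials [p_m] in the basis [(bz, b/z; q)_k] makes the matrix lower
   triangular, with last diagonal entry proportional to [p_n]. *)
Lemma det_aw_matrix_mul (F : fieldType) (q a b c d z : F) n :
  q != 0 -> (forall k, q ^+ k.+1 != 1) ->
  (forall k, (k < 2 * n - 1)%N -> a * b * c * d * q ^+ k != 1) ->
  \det (aw_matrix q a b c d z n) * \prod_(m < n.+1) aw_coef q b a c d m m =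
  (\prod_(i < n) aw_pivot q a b c d i i) * aw_sum q b a c d z n.
Proof.
move=> q0 q1 s1.
pose U := \matrix_(k < n.+1, m < n.+1)
  (if (k <= m)%N then aw_coef q b a c d m k else 0 : F).
have -> : \prod_(m < n.+1) aw_coef q b a c d m m = \det U.
  rewrite -det_tr det_trig; last first.
    by apply/is_trig_mxP => i j ltij; rewrite !mxE leqNgt ltij.
  by apply: eq_bigr => m _; rewrite !mxE leqnn.
have AU (i m : 'I_n.+1) : (aw_matrix q a b c d z n *m U) i m =
    \sum_(k < m.+1) aw_entry q a b c d z n i k * aw_coef q b a c d m k.
  rewrite mxE -(sum_ord_widen_if (aw_entry q a b c d z n i)
    (aw_coef q b a c d m) (n := n)); last by rewrite -ltnS.
  by apply: eq_bigr => k _; rewrite !mxE.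
have AUlt (i m : 'I_n.+1) : (i < n)%N ->
    (aw_matrix q a b c d z n *m U) i m = aw_pivot q a b c d i m.
  move=> ltin; rewrite AU -aw_row_sum //; last first.
    (* Since [i <= n - 1] and [m <= n], the exponents in (abcd; q)_(i+m) stay below 2n - 1. *)
    apply: qpoch_neq0 => k ltk; apply: s1; have := ltn_ord m; lia.
  by apply: eq_bigr => k _; rewrite /aw_entry ltin.
rewrite -det_mulmx det_trig; last first.
  apply/is_trig_mxP => i m ltim; rewrite AUlt ?aw_pivot_eq0 //.
  by have := ltn_ord m; lia.
rewrite big_ord_recr /=; congr (_ * _).
  by apply: eq_bigr => i _; rewrite AUlt /=.
rewrite AU; apply: eq_bigr => k _.
by rewrite /aw_entry /= ltnn mulrC.
Qed.

(** * Evaluation of the constant *)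

(** Both sides are g(n) ... g(2n+1). This relates the denominators of [aw_const] at [n] and [n + 1],
    whose index ranges are shifted. *)
Lemma prod_ord_shift (R : comPzRingType) (g : nat -> R) n :
  g n * \prod_(i < n.+1) g (n.+1 + i)%N =
  \prod_(i < n) g (n + i)%N * (g (n + n)%N * g (n + n).+1).
Proof.
transitivity (\prod_(i < n.+2) g (n + i)%N).
  rewrite [RHS]big_ord_recl addn0; congr (_ * _).
  by apply: eq_bigr => i _; rewrite /= /bump add1n addSnnS.
by rewrite !big_ord_recr /= addnS mulrA.
Qed.

Lemma aw_constS (F : fieldType) (q a b c d : F) n :
  (forall k, (k < 2 * n.+1 - 1)%N -> a * b * c * d * q ^+ k != 1) ->
  aw_const q a b c d n.+1 = aw_const q a b c d n *
    (- (a ^+ n * b ^+ n.+1 * q ^+ (n * n)) *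
     qpochs q [:: a * b; a * c; a * d; b * c; b * d; c * d; q] n *
     (qpoch q (a * b * c * d) n /
      (qpoch q (a * b * c * d) (n + n) * qpoch q (a * b * c * d) (n + n).+1))).
Proof.
move=> s1.
have s0 k : (k <= (n + n).+1)%N -> qpoch q (a * b * c * d) k != 0.
  by move=> lek; apply: qpoch_neq0 => j ltj; apply: s1; lia.
rewrite /aw_const.
(* The three exponents grow by n, n + 1 and n^2: each numerator grows by that multiple of its
   divisor, which passes through the quotient. *)
have -> : (n.+1 * (n.+1 - 1) %/ 2 = n * (n - 1) %/ 2 + n)%N.
  by rewrite [RHS]addnC -divnMDl //; congr (_ %/ 2)%N; case: n {s1 s0} => //; nia.
have -> : (n.+1 * (n.+1 + 1) %/ 2 = n * (n + 1) %/ 2 + n.+1)%N.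
  by rewrite [RHS]addnC -divnMDl //; congr (_ %/ 2)%N; nia.
have -> : (n.+1 * (n.+1 - 1) * (2 * n.+1 - 1) %/ 6 =
           n * (n - 1) * (2 * n - 1) %/ 6 + n * n)%N.
  rewrite [RHS]addnC -divnMDl //; congr (_ %/ 6)%N.
  case: n {s1 s0} => // n.
  have -> : (2 * n.+2 - 1 = 2 * n + 3)%N by lia.
  have -> : (2 * n.+1 - 1 = 2 * n + 1)%N by lia.
  rewrite !subSS !subn0.
  nia.
rewrite !exprD exprSr !prodf_div big_ord_recr /=.
have := prod_ord_shift (qpoch q (a * b * c * d)) n.
set P := \prod_(i < n.+1) _; set P' := \prod_(i < n) qpoch _ _ _.
have P0 : P != 0.
  by apply/prodf_neq0 => i _; apply: s0; have := ltn_ord i; lia.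
have P'0 : P' != 0.
  by apply/prodf_neq0 => i _; apply: s0; have := ltn_ord i; lia.
have g0 : qpoch q (a * b * c * d) n != 0 by apply: s0; lia.
have g1 : qpoch q (a * b * c * d) (n + n) != 0 by apply: s0; lia.
have g2 : qpoch q (a * b * c * d) (n + n).+1 != 0 by apply: s0; lia.
move: g0 g1 g2; move: (qpoch _ _ n) (qpoch _ _ (n + n)) (qpoch _ _ _.+1).
move=> x y t x0 y0 t0 E.
have {E} -> : P = P' * (y * t) / x by rewrite -E [x * P]mulrC mulfK.
move: (qpochs _ _ _) => X.
by field; rewrite P'0 x0 y0 t0.
Qed.

(** The power [b ^+ n] is the normalization of p_n written in terms of b. By induction, it suffices
    to compare the new pivot and the new leading coefficient with the ratio given by [aw_constS]. *)
Lemma prod_aw_pivot (F : fieldType) (q a b c d : F) n :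
  q != 0 -> (forall k, q ^+ k.+1 != 1) ->
  (forall k, (k < 2 * n - 1)%N -> a * b * c * d * q ^+ k != 1) ->
  b ^+ n * \prod_(i < n) aw_pivot q a b c d i i =
  aw_const q a b c d n * \prod_(m < n.+1) aw_coef q b a c d m m.
Proof.
move=> q0 q1; elim: n => [|n IHn] s1.
  rewrite !big_ord0 big_ord1 /aw_const big_ord0 /aw_coef !qpoch0.
  by rewrite !expr0 !mulr1 divr1 mulr1.
rewrite big_ord_recr [in RHS]big_ord_recr /= aw_constS // exprSr.
rewrite mulrACA IHn => [|k ltk]; last by apply: s1; lia.
rewrite [RHS]mulrACA; congr (_ * _); rewrite /aw_pivot /aw_coef subnn !qpoch0.
rewrite !qpochs_cons !qpochs_nil.
have s0 k : (k <= (n + n).+1)%N -> qpoch q (a * b * c * d) k != 0.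
  by move=> lek; apply: qpoch_neq0 => j ltj; apply: s1; lia.
have := s0 _ (leqnn (n + n).+1); have := s0 _ (leqnSn (n + n)).
have -> : b * a * c * d * q ^+ n.+1 / q = a * b * c * d * q ^+ n.
  by rewrite exprSr (mulrC b a) mulrA mulfK.
(* The leading coefficient contains (abcdq^n; q)_(n+1), the quotient of (abcd; q)_(2n+1) by (abcd;
   q)_n. *)
rewrite -addnS (qpochD q _ n n.+1) mulf_eq0 negb_or => y0 /andP[x0 t0].
rewrite (qpochSl q (q ^- n.+1)).
have -> : q ^- n.+1 * q = q ^- n by rewrite exprSr invfM mulfVK.
rewrite (qpochS q q) !exprMn -exprM.
have := q1 n; have := qpochqq_neq0 n q1; have := expf_neq0 n q0.
rewrite !exprS.
move: (qpoch q (a * b * c * d) n) (qpoch q (a * b * c * d) (n + n))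
  (qpoch q (_ * q ^+ n) n.+1) x0 y0 t0 => x y t x0 y0 t0.
move: (qpoch q (q ^- n) n) (qpoch q q n) (q ^+ (n * n)) => A Q B.
move: (q ^+ n) => u u0 Q0 qu.
field; rewrite q0 u0 Q0 x0 y0 t0 /=.
by rewrite subr_eq0 eq_sym qu.
Qed.

(** * The determinant formula *)

Lemma askey_wilson_zE (F : fieldType) (q a b c d z : F) n :
  q != 0 -> (0 < n)%N -> qpoch q (a * b) n != 0 -> qpoch q (a * c) n != 0 ->
  qpoch q (a * d) n != 0 ->
  askey_wilson_z q a b c d n z = aw_sum q a b c d z n / a ^+ n.
Proof.
move=> q0 n0 ab0 ac0 ad0; rewrite /askey_wilson_z mulrAC; congr (_ / _).
rewrite mulr_sumr; apply: eq_bigr => -[k ltkn] _ /=.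
rewrite /aw_coef !qpochs_cons !qpochs_nil.
have -> : a * b * c * d * q ^+ n / q = a * b * c * d * q ^+ n.-1.
  by rewrite -{1}(prednK n0) exprSr mulrA mulfK.
have D (x : F) : qpoch q x n = qpoch q x k * qpoch q (x * q ^+ k) (n - k).
  by rewrite -qpochD subnKC.
move: ab0 ac0 ad0; rewrite !D !mulf_eq0 !negb_or.
move=> /andP[ab0 _] /andP[ac0 _] /andP[ad0 _].
(* Here q may be a root of unity; if (q; q)_k = 0, both terms are 0 because the inverse of 0 is
   0. *)
have [->|Q0] := eqVneq (qpoch q q k) 0; first by rewrite !(mul0r, invr0, mulr0).
by field; rewrite ab0 ac0 ad0 Q0.
Qed.

(** For b = 0 the first and last rows consist of ones. This case is separate because Sears'
    transformation divides by b. *)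
Lemma det_aw_matrix_b0 (F : fieldType) (q a c d z : F) n : (0 < n)%N ->
  \det (aw_matrix q a 0 c d z n) = 0.
Proof.
move=> n0; apply: (@determinant_alternate _ _ _ ord0 ord_max).
  by rewrite -val_eqE /= neq_ltn n0.
move=> j; rewrite !mxE /aw_entry n0 ltnn !qpochs_cons !qpochs_nil !qpoch0.
have q0E m : qpoch q 0 m = 1.
  by apply: big1 => i _; rewrite mul0r subr0.
by rewrite !(mul0r, mulr0) !q0E !mulr1 divr1 mulr1.
Qed.

Lemma det_aw_matrix (F : fieldType) (q a b c d z : F) n :
  q != 0 -> (forall k, q ^+ k.+1 != 1) -> (0 < n)%N -> z != 0 -> a != 0 ->
  (forall k, (k < 2 * n - 1)%N -> a * b * c * d * q ^+ k != 1) ->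
  (forall k, (k < n)%N -> a * b * q ^+ k != 1) ->
  (forall k, (k < n)%N -> a * c * q ^+ k != 1) ->
  (forall k, (k < n)%N -> a * d * q ^+ k != 1) ->
  \det (aw_matrix q a b c d z n) =
  aw_const q a b c d n * askey_wilson_z q a b c d n z.
Proof.
move=> q0 q1 n0 z0 a0 s1 ab1 ac1 ad1.
have [b0|b0] := eqVneq b 0.
  have n2 : (0 < (n * (n + 1)) %/ 2)%N by rewrite divn_gt0 //; nia.
  by rewrite b0 det_aw_matrix_b0 // /aw_const expr0n gtn_eqF // !(mulr0, mul0r).
rewrite askey_wilson_zE ?qpoch_neq0 // (aw_sum_sears a c d n q0 q1 b0 z0).
(* The determinant of the triangular multiplier must be nonzero to be cancelled. *)
have coef0 : \prod_(m < n.+1) aw_coef q b a c d m m != 0.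
  apply/prodf_neq0 => m _; have ltmn := ltn_ord m.
  rewrite /aw_coef subnn !qpoch0 !mulf_neq0 ?invr_neq0 ?oner_neq0 ?expf_neq0 //.
  - apply: qpoch_neq0 => k ltkm.
    have -> : nat_of_ord m = ((m - k.+1).+1 + k)%N by lia.
    by rewrite exprD invfM mulfVK ?expf_neq0 // invr_eq1 q1.
  - exact: qpochqq_neq0.
  (* The exponents in (abcdq^(m-1); q)_m are at most 2m - 2, hence below 2n - 1. *)
  apply: qpoch_neq0 => k ltkm; have m0 : (0 < m)%N by lia.
  rewrite -(prednK m0) exprSr mulrA mulfK // -mulrA -exprD (mulrC b a).
  by apply: s1; lia.
apply: (mulIf coef0); rewrite det_aw_matrix_mul //.
have := prod_aw_pivot q0 q1 s1.
move: (\prod_(m < n.+1) _) coef0 (\prod_(i < n) _) => C C0 P E.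
have bn0 := expf_neq0 n b0; have an0 := expf_neq0 n a0.
rewrite (_ : P = aw_const q a b c d n * C / b ^+ n); last first.
  by rewrite -E mulrAC divff // mul1r.
rewrite expr_div_n; field; rewrite an0; exact: bn0.
Qed.

(* Genericity of a, b, c, d: no denominator occurring in the matrix, in the
   constant or in the Askey-Wilson polynomial vanishes. *)
Theorem theorem4p1 (R : realType) (q : R) (a b c d z x : R[i]) (n : nat)
    (hq0 : 0 < q) (hq1 : q < 1)
    (hn : (1 <= n)%N)
    (hz : z != 0)
    (hx : x = (z + z^-1) / 2%:R)
    (ha : a != 0)
    (habcd : forall k : nat, (k < 2 * n - 1)%N -> a * b * c * d * q%:C ^+ k != 1)
    (hab : forall k : nat, (k < n)%N -> a * b * q%:C ^+ k != 1)
    (hac : forall k : nat, (k < n)%N -> a * c * q%:C ^+ k != 1)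
    (had : forall k : nat, (k < n)%N -> a * d * q%:C ^+ k != 1) :
  \det (aw_matrix q%:C a b c d z n) =
    aw_const q%:C a b c d n * askey_wilson q%:C a b c d n x.
Proof.
rewrite hx askey_wilsonE //; apply: det_aw_matrix => //.
  by rewrite fmorph_eq0 gt_eqF.
move=> k; rewrite -rmorphXn fmorph_eq1 lt_eqF //.
by rewrite exprn_ilt1 // ltW.
Qed.
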